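(* Let $p$ be a prime and $n\ge1$. The simplex ${\rm IRS}_\ast(\mathcal{L}_{n,p})$ is a Poulsen simplex.
   Context: $\mathcal{L}_{n,p}=(\mathbb{Z}/p\mathbb{Z})^n\wr\mathbb{Z}=\left(\bigoplus_{\mathbb{Z}}(\mathbb{Z}/p\mathbb{Z})^n\right)\rtimes\mathbb{Z}$. For a countable group $G$, ${\rm Sub}(G)$ is the compact metrizable space of subgroups of $G$ with the topology induced from $\{0,1\}^G$ (pointwise convergence of characteristic functions); $G$ acts on it by conjugation. The perfect kernel $\mathcal{K}(G)$ of ${\rm Sub}(G)$ is its unique perfect subset with countable complement. ${\rm IRS}_\ast(G)$ denotes the set of conjugation-invariant Borel probability measures on ${\rm Sub}(G)$ supported on $\mathcal{K}(G)$, with the weak$^*$ topology; it is a simplex. A Poulsen simplex is a (metrizable) simplex whose extreme points form a dense subset. *)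

(* Defs.v *)
From HB Require Import structures.
From mathcomp Require Import all_boot all_order all_algebra.
From mathcomp Require Import all_classical all_reals all_analysis.
From mathcomp Require Import zify.

Set Implicit Arguments.
Unset Strict Implicit.
Unset Printing Implicit Defensive.

Import Order.TTheory GRing.Theory Num.Theory.
Import numFieldNormedType.Exports.

Local Open Scope classical_set_scope.
Local Open Scope ring_scope.

Section Lamplighter.
Variables (p n : nat).

Definition lvec := 'rV['F_p]_n.

Definition finsupp (f : int -> lvec) :=
  exists N : nat, forall m : int, (N < absz m)%N -> f m = 0.

(** elements of (⊕_Z (Z/pZ)^n) ⋊ Z : pairs (f, k) *)
Record lamp := Lamp {
  lamp_f : int -> lvec;
  lamp_k : int;
  lamp_fin : finsupp lamp_f }.

Lemma finsupp0 : finsupp (fun _ => 0).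
Proof. by exists 0%N. Qed.

Lemma absz_sub_ge (m k : int) : (absz m <= absz (m - k)%R + absz k)%N.
Proof. lia. Qed.

Lemma absz_add_ge (m k : int) : (absz m <= absz (m + k)%R + absz k)%N.
Proof. lia. Qed.

Lemma finsupp_mul (f f' : int -> lvec) (k : int) :
  finsupp f -> finsupp f' -> finsupp (fun m => f m + f' (m - k)).
Proof.
move=> [N1 H1] [N2 H2]; exists (N1 + N2 + absz k)%N => m hm.
have hm1 : (N1 < absz m)%N by lia.
have := absz_sub_ge m k => hs.
have hm2 : (N2 < absz (m - k)%R)%N by lia.
by rewrite H1 // H2 // addr0.
Qed.

Lemma finsupp_inv (f : int -> lvec) (k : int) :
  finsupp f -> finsupp (fun m => - f (m + k)).
Proof.
move=> [N H]; exists (N + absz k)%N => m hm.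
have := absz_add_ge m k => hs.
have hm' : (N < absz (m + k)%R)%N by lia.
by rewrite H // oppr0.
Qed.

(** group law: (f,k)(f',k') = (f + (shift by k of f'), k + k') *)
Definition lamp_one : lamp := Lamp 0 finsupp0.
Definition lamp_mul (x y : lamp) : lamp :=
  Lamp (lamp_k x + lamp_k y) (finsupp_mul (lamp_k x) (lamp_fin x) (lamp_fin y)).
Definition lamp_inv (x : lamp) : lamp :=
  Lamp (- lamp_k x) (finsupp_inv (lamp_k x) (lamp_fin x)).

(** Sub(L_{n,p}) inside {0,1}^G with the product (pointwise) topology *)
Definition SubSpace := {ptws lamp -> bool}.

Definition is_subgroup (H : lamp -> bool) : Prop :=
  H lamp_one /\ forall x y, H x -> H y -> H (lamp_mul x (lamp_inv y)).

Definition SubG : set SubSpace := [set H | is_subgroup H].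

Definition conjS (g : lamp) (H : SubSpace) : SubSpace :=
  fun x => H (lamp_mul (lamp_mul (lamp_inv g) x) g).

Definition is_perfect_kernel (K : set SubSpace) : Prop :=
  K `<=` SubG /\ perfect_set K /\ countable (SubG `\` K).

Definition BorelSub := g_sigma_algebraType (@open SubSpace).

Section Measures.
Variable R : realType.

Definition IRS_star (K : set SubSpace) (mu : probability BorelSub R) : Prop :=
  mu (K : set BorelSub) = 1%E /\
  forall (g : lamp) (A : set BorelSub), measurable A ->
    mu ((conjS g) @^-1` A) = mu A.

Definition IRS_extreme (K : set SubSpace) (nu : probability BorelSub R) : Prop :=
  IRS_star K nu /\
  forall (m1 m2 : probability BorelSub R) (t : R),
    IRS_star K m1 -> IRS_star K m2 -> 0 < t < 1 ->
    (forall A : set BorelSub, measurable A ->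
        nu A = (t%:E * m1 A + (1 - t)%:E * m2 A)%E) ->
    forall A : set BorelSub, measurable A -> m1 A = nu A /\ m2 A = nu A.

(** density of the extreme points in the weak-* topology: every basic weak-*
    neighbourhood of every mu in IRS_* (given by finitely many continuous
    functions fs 0, ..., fs (m-1) and eps > 0) contains an extreme point *)
Definition IRS_extreme_dense (K : set SubSpace) : Prop :=
  forall mu : probability BorelSub R, IRS_star K mu ->
  forall (m : nat) (fs : nat -> SubSpace -> R) (eps : R),
    (forall i, (i < m)%N -> continuous (fs i)) -> 0 < eps ->
    exists nu : probability BorelSub R,
      IRS_extreme K nu /\
      forall i, (i < m)%N ->
        (`| \int[nu]_x (fs i x)%:E - \int[mu]_x (fs i x)%:E | < eps%:E)%E.

End Measures.
End Lamplighter.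

(* Main.v *)
(** Every subgroup of the lamplighter group that is not contained in the base
    [A = (+)_Z F_p^n] contains, besides an element of minimal shift [k > 0], an
    [F_p[t^k, t^-k]]-submodule of [A]; by noetherianity it is finitely generated,
    so there are countably many of them.  As [Sub(A)] is perfect, it is the
    perfect kernel, and an element of [IRS_*] is a shift-invariant probability
    measure on [Sub(A)].

    Such a measure [mu] is approximated by measures carried by a finite orbit,
    which are extreme.  Sample finitely many subgroups [H_j] of [A] whose
    empirical distribution is close to [mu], cut each of them to a window
    [[0, L)], and put the pieces side by side, periodically in [j].  The direct
    sum [W] is a periodic point of the shift, and a fixed finite window placed
    along the orbit of [W] sees, except near the ends of the blocks, exactly what
    it sees along the orbits of the [H_j].  Hence the uniform measure on the
    orbit of [W] is weak-* close to [mu]. *)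
Require Import Defs.
From HB Require Import structures.
From mathcomp Require Import all_boot all_order all_algebra.
From mathcomp Require Import all_classical all_reals all_analysis.
From mathcomp Require Import measurable_realfun.
From mathcomp Require Import zify ring lra.

Set Implicit Arguments.
Unset Strict Implicit.
Unset Printing Implicit Defensive.

Import Order.TTheory GRing.Theory Num.Theory.
Import numFieldNormedType.Exports.

Local Open Scope classical_set_scope.
Local Open Scope ring_scope.

(** * Closed sets of binary functions *)

Section BinaryFunctions.
Variable I : Type.
Implicit Types (x y : {ptws I -> bool}) (s : seq I).

(** These cylinders form a neighbourhood basis at [x]; they reduce every topological argument below
    to finite lists of coordinates. *)
Definition agree s x : set {ptws I -> bool} :=
  [set y | all (fun g => y g == x g) s].

Lemma agree_refl s x : agree s x x.
Proof. by rewrite /agree /=; elim: s => //= a s ->; rewrite eqxx. Qed.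

Lemma agree_sym s x y : agree s x y -> agree s y x.
Proof.
by rewrite /agree /=; elim: s => //= a s IH /andP[/eqP -> /IH ->]; rewrite eqxx.
Qed.

Lemma agree_trans s x y z : agree s x y -> agree s y z -> agree s x z.
Proof.
rewrite /agree /=; elim: s => //= a s IH /andP[/eqP <- h1] /andP[-> h2].
exact: IH.
Qed.

Lemma agree_cat s1 s2 x y : agree (s1 ++ s2) x y <-> agree s1 x y /\ agree s2 x y.
Proof. by rewrite /agree /= all_cat; split=> [/andP|[-> ->]]. Qed.

Lemma continuous_eval (g : I) : continuous (fun x : {ptws I -> bool} => x g).
Proof. exact: (@proj_continuous {classic I} (fun=> bool) g). Qed.

Lemma nbhs_eval (g : I) x : nbhs x [set y : {ptws I -> bool} | y g = x g].
Proof.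
apply: (@continuous_eval g x [set b | b = x g]).
by rewrite nbhs_principalE; apply/principal_filterP.
Qed.

Lemma nbhs_agree s x : nbhs x (agree s x).
Proof.
elim: s => [|a s IH]; first exact: filterE.
apply: filterS (filterI (nbhs_eval a x) IH) => y [/= h1 h2].
by rewrite /agree /= h1 eqxx.
Qed.

Let agree_filter x : set_system {ptws I -> bool} :=
  filter_from setT (fun s => agree s x).

Let agree_filter_filter x : Filter (agree_filter x).
Proof.
apply: filter_from_filter; first by exists [::].
move=> s1 s2 _ _; exists (s1 ++ s2) => // y /agree_cat //.
Qed.

(** The pointwise topology is the supremum of those pulled back along the evaluations, and [bool] is
    discrete, so convergence is tested on one coordinate at a time. *)
Lemma cvg_ptws (F : set_system {ptws I -> bool}) x : Filter F ->
  (forall g, F [set y | y g = x g]) -> F --> x.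
Proof.
move=> FF h; apply/(@cvg_sup _ {classic I}) => g U [V] [[W] oW <-] /= Wx VU.
apply: filterS (h g) => y /= yx; apply: VU => /=.
by move: Wx; rewrite /proj -yx.
Qed.

(** The filter generated by the cylinders at [x] converges to [x], hence contains every
    neighbourhood. *)
Lemma nbhs_agreeP x U : nbhs x U -> exists s, agree s x `<=` U.
Proof.
move=> hU.
have : agree_filter x --> x.
  apply: (cvg_ptws (agree_filter_filter x)) => g; exists [:: g] => // y /=.
  by rewrite /agree /= andbT => /eqP.
by move=> /(_ _ hU) [s _ hs]; exists s.
Qed.

Lemma compact_ptws : compact [set: {ptws I -> bool}].
Proof.
have := @tychonoff {classic I} (fun=> bool) (fun=> setT) (fun=> bool_compact).
by congr compact; apply/seteqP; split.
Qed.

(** Uniform continuity from compactness in its near-covering form: locally a list [s] works, and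
    lists can be refined. *)
Lemma agree_uniform (R : realType) (f : {ptws I -> bool} -> R) (e : R) :
  continuous f -> 0 < e -> exists s, forall x y, agree s x y -> `|f x - f y| < e.
Proof.
move=> cf e0.
(* The filter of fine enough lists: a member contains, for some [s], every [t] whose cylinders lie
   in those of [s]. *)
pose F : set_system (seq I) :=
  filter_from setT (fun s => [set t | forall x, agree t x `<=` agree s x]).
have FF : Filter F.
  apply: filter_from_filter; first by exists [::].
  move=> s1 s2 _ _; exists (s1 ++ s2) => // t /= ht.
  by split=> x y /ht /agree_cat [].
have := compact_ptws; rewrite compact_near_coveringP.
move=> /(_ _ F (fun s x => forall y, agree s x y -> `|f x - f y| < e) FF) [].
  move=> x _.
  have : nbhs x (f @^-1` ball (f x) (e / 2)).
    by apply: cf; apply: nbhsx_ballx; rewrite divr_gt0.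
  move=> /nbhs_agreeP [s hs].
  exists (agree s x, [set t | forall x, agree t x `<=` agree s x]).
    by split; [exact: nbhs_agree | exists s].
  move=> [y t] /= [hy ht] z hz.
  have h1 : `|f x - f y| < e / 2 by exact: (hs _ hy).
  have h2 : `|f x - f z| < e / 2.
    by apply: (hs z); apply: agree_trans hy _; apply: ht.
  by rewrite (splitr e) (le_lt_trans (ler_distD (f x) _ _))// ltrD// distrC.
move=> s _ hs; exists s => x y.
by apply: (hs s (fun=> @subset_refl _ _) x).
Qed.

Lemma continuous_bounded (R : realType) (f : {ptws I -> bool} -> R) :
  continuous f -> exists2 B, 0 < B & forall x, `|f x| <= B.
Proof.
move=> cf.
have := continuous_compact (continuous_subspaceT cf) compact_ptws.
move=> /compact_bounded [B [_ hB]]; exists (`|B| + 1); first by rewrite ltr_wpDl.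
move=> x; apply: (hB (`|B| + 1)); last by exists x.
by rewrite (le_lt_trans (ler_norm _)) // ltrDl.
Qed.

Lemma agree_uniform_family (R : realType) (m : nat)
    (f : nat -> {ptws I -> bool} -> R) (e : R) :
  (forall i, (i < m)%N -> continuous (f i)) -> 0 < e ->
  exists s, forall i x y, (i < m)%N -> agree s x y -> `|f i x - f i y| < e.
Proof.
move=> + e0; elim: m => [|m IH] cf; first by exists [::].
have [s hs] := IH (fun i im => cf i (ltnW im)).
have [t ht] := agree_uniform (cf m (ltnSn m)) e0.
exists (s ++ t) => i x y; rewrite ltnS leq_eqVlt => /orP[/eqP ->|im] /agree_cat [].
  by move=> _; exact: ht.
by move=> xy _; exact: hs.
Qed.

Lemma continuous_bounded_family (R : realType) (m : nat)
    (f : nat -> {ptws I -> bool} -> R) :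
  (forall i, (i < m)%N -> continuous (f i)) ->
  exists2 B, 0 < B & forall i x, (i < m)%N -> `|f i x| <= B.
Proof.
elim: m => [|m IH] cf; first by exists 1.
have [B B0 hB] := IH (fun i im => cf i (ltnW im)).
have [C C0 hC] := continuous_bounded (cf m (ltnSn m)).
exists (B + C); first exact: addr_gt0.
move=> i x; rewrite ltnS leq_eqVlt => /orP[/eqP ->|im].
  by rewrite (le_trans (hC x))// lerDr ltW.
by rewrite (le_trans (hB i x im))// lerDl ltW.
Qed.

Lemma closed_agreeP (A : set {ptws I -> bool}) :
  (forall x, (forall s, exists2 y, A y & agree s x y) -> A x) -> closed A.
Proof.
move=> h x clx; apply: h => s.
by have [y [Ay xy]] := clx _ (nbhs_agree s x); exists y.
Qed.

Lemma limit_point_agree (A : set {ptws I -> bool}) x :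
  limit_point A x <-> forall s, exists2 y, A y & agree s x y /\ y <> x.
Proof.
split=> [h s|h U /nbhs_agreeP [s sU]].
  by have [y [/eqP yx Ay hy]] := h _ (nbhs_agree s x); exists y.
by have [y Ay [xy /eqP yx]] := h s; exists y; split=> //; apply: sU.
Qed.

(* Cantor's diagonal argument: shrink cylinders centred in [P] so that they
   avoid the listed points one by one, and use compactness. *)
Lemma perfect_open_countable (P U : set {ptws I -> bool}) :
  perfect_set P -> open U -> countable (P `&` U) -> P `&` U = set0.
Proof.
move=> [cP lP] oU /countable_injP [f finj].
apply/eqP/negPn/negP => /set0P [x0 [Px0 Ux0]].
have step (q : {ptws I -> bool} * seq I) (a : nat) :
  exists q' : {ptws I -> bool} * seq I, P q.1 -> [/\ P q'.1,
    agree q'.2 q'.1 `<=` agree q.2 q.1 &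
    forall z, P z -> U z -> f z = a -> ~ agree q'.2 q'.1 z].
  case: q => x s /=.
  have [Px|nPx] := pselect (P x); last by exists (x, s).
  have [[z [Pz Uz fz]]|hz] := pselect (exists z, [/\ P z, U z & f z = a]); last first.
    exists (x, s) => _; split=> // z Pz Uz fz _; apply: hz; by exists z.
  have avoid y g : y g != z g -> P y -> agree s x y ->
      P (y, g :: s).1 -> [/\ P y, agree (g :: s) y `<=` agree s x &
    forall w, P w -> U w -> f w = a -> ~ agree (g :: s) y w].
    move=> yz Py xy _; split=> //.
      by move=> w /andP[_]; apply: agree_trans.
    move=> w Pw Uw fw; have -> : w = z.
      by apply: finj; rewrite ?inE//; rewrite fw.
    by move=> /andP[/eqP zy]; rewrite zy eqxx in yz.
  (* If the centre is the point [z] to be avoided, perfectness of [P] supplies another centre in the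
     cylinder; otherwise one more coordinate separates them. *)
  have [xz|/eqP xz] := eqVneq x z.
    have : limit_point P x by rewrite lP.
    move=> /limit_point_agree /(_ s) [y Py [xy yx]].
    have [g /eqP yg] : exists g, y g <> x g.
      by apply/existsNP => h; apply: yx; apply/funext.
    by exists (y, g :: s) => _; apply: avoid; rewrite -?xz.
  have [g /eqP xg] : exists g, x g <> z g.
    by apply/existsNP => h; apply: xz; apply/funext.
  exists (x, g :: s) => _; apply: avoid => //; exact: agree_refl.
have [s0 s0U] : exists s, agree s x0 `<=` U.
  by apply: nbhs_agreeP; apply: open_nbhs_nbhs.
have [F hF] := choice (fun qa => step qa.1 qa.2).
pose u := fix u n := if n is m.+1 then F (u m, m) else (x0, s0).
have Pu n : P (u n).1 by elim: n => //= n IH; have [] := hF (u n, n) IH.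
have dec n m : agree (u (n + m)%N).2 (u (n + m)%N).1 `<=` agree (u n).2 (u n).1.
  elim: m => [|m IH]; first by rewrite addn0.
  rewrite addnS /=; have [_ h _] := hF (u (n + m)%N, (n + m)%N) (Pu _).
  exact: subset_trans h IH.
(* The cylinders are nested and clopen, so a cluster point of the centres lies in all of them; being
   in [P] and [U], it was excluded at stage [f z]. *)
have [z [_ zcl]] := compact_ptws (F := (fun n => (u n).1) @ \oo) _ filterT.
have zu n : agree (u n).2 (u n).1 z.
  have hn : ((fun n => (u n).1) @ \oo) [set (u (n + m)%N).1 | m in setT].
    by exists n => // m /= nm; exists (m - n)%N => //; rewrite subnKC.
  have [w [[m _ <-] zw]] := zcl _ _ hn (nbhs_agree (u n).2 z).
  apply: agree_trans (agree_sym zw); apply: dec; exact: agree_refl.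
have Pz : P z.
  apply: cP => V /(zcl _ V); apply.
  by exists 0%N => // m _ /=; exact: Pu.
have Uz : U z by apply: s0U; exact: (zu 0%N).
have [_ _ /(_ z Pz Uz erefl)] := hF (u (f z), f z) (Pu _); apply.
exact: (zu (f z).+1).
Qed.

End BinaryFunctions.

Lemma continuous_precomp (I J : Type) (phi : J -> I) :
  continuous (fun x : {ptws I -> bool} => (x \o phi : {ptws J -> bool})).
Proof.
move=> x; apply: cvg_ptws => g; exact: (nbhs_eval (phi g) x).
Qed.

(** * The lamplighter group *)

Section LampGroup.
Variables p n : nat.
Local Notation lamp := (lamp p n).
Implicit Types (x y z g : lamp) (H : SubSpace p n).

Lemma lamp_eq x y : lamp_f x =1 lamp_f y -> lamp_k x = lamp_k y -> x = y.
Proof.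
case: x y => f k hf [f' k' hf'] /= /funext e ek; subst f' k'.
by congr Lamp; apply: Prop_irrelevance.
Qed.

Lemma lamp_mulA x y z : lamp_mul x (lamp_mul y z) = lamp_mul (lamp_mul x y) z.
Proof.
apply: lamp_eq => [m|] /=; last by rewrite addrA.
by rewrite addrA opprD addrA.
Qed.

Lemma lamp_mul1 x : lamp_mul (lamp_one p n) x = x.
Proof. by apply: lamp_eq => [m|] /=; rewrite ?subr0 add0r. Qed.

Lemma lamp_mulr1 x : lamp_mul x (lamp_one p n) = x.
Proof. by apply: lamp_eq => [m|] /=; rewrite addr0. Qed.

Lemma lamp_mulV x : lamp_mul (lamp_inv x) x = lamp_one p n.
Proof. by apply: lamp_eq => [m|] /=; rewrite ?opprK addNr. Qed.

Lemma lamp_mulrV x : lamp_mul x (lamp_inv x) = lamp_one p n.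
Proof. by apply: lamp_eq => [m|] /=; rewrite ?subrK subrr. Qed.

Lemma lamp_invK x : lamp_inv (lamp_inv x) = x.
Proof. by apply: lamp_eq => [m|] /=; rewrite ?subrK opprK. Qed.

Lemma lamp_mulK x y : lamp_mul (lamp_mul x y) (lamp_inv y) = x.
Proof. by rewrite -lamp_mulA lamp_mulrV lamp_mulr1. Qed.

Lemma lamp_mulKV x y : lamp_mul (lamp_inv x) (lamp_mul x y) = y.
Proof. by rewrite lamp_mulA lamp_mulV lamp_mul1. Qed.

Lemma lamp_invM x y : lamp_inv (lamp_mul x y) = lamp_mul (lamp_inv y) (lamp_inv x).
Proof.
apply/esym; rewrite -[LHS](lamp_mulK _ (lamp_mul x y)).
by rewrite -(lamp_mulA _ _ (lamp_mul x y)) lamp_mulKV lamp_mulV lamp_mul1.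
Qed.

Lemma subgroup1 H : is_subgroup H -> H (lamp_one p n).
Proof. by case. Qed.

Lemma subgroupV H x : is_subgroup H -> H x -> H (lamp_inv x).
Proof. by move=> [H1 Hd] Hx; rewrite -[lamp_inv x]lamp_mul1; apply: Hd. Qed.

Lemma subgroupM H x y : is_subgroup H -> H x -> H y -> H (lamp_mul x y).
Proof.
move=> hH Hx Hy; rewrite -[y]lamp_invK; apply: (hH.2) => //.
exact: subgroupV.
Qed.

Lemma subgroupMr H x y : is_subgroup H -> H y -> H (lamp_mul x y) = H x.
Proof.
move=> hH Hy; apply/idP/idP => h; last exact: subgroupM.
by rewrite -(lamp_mulK x y); apply: hH.2.
Qed.

Lemma subgroupMl H x y : is_subgroup H -> H x -> H (lamp_mul x y) = H y.
Proof.
move=> hH Hx; apply/idP/idP => h; last exact: subgroupM.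
by rewrite -(lamp_mulKV x y); apply: subgroupM => //; apply: subgroupV.
Qed.

Lemma subgroupVE H x : is_subgroup H -> H (lamp_inv x) = H x.
Proof.
move=> hH; apply/idP/idP => h; last exact: subgroupV.
by rewrite -(lamp_invK x); apply: subgroupV.
Qed.

Lemma conj_lamp_k g x :
  lamp_k (lamp_mul (lamp_mul (lamp_inv g) x) g) = lamp_k x.
Proof. by rewrite /= addrAC addNr add0r. Qed.

Lemma conj_lamp_f g x m : lamp_k x = 0 ->
  lamp_f (lamp_mul (lamp_mul (lamp_inv g) x) g) m = lamp_f x (m + lamp_k g).
Proof. by move=> /= ->; rewrite addr0 opprK addrAC addNr add0r. Qed.

(** The sign is chosen so that [lamp_shift i] moves a configuration by [i] to the right. *)
Definition shifter (i : int) : lamp := Lamp (- i) (finsupp0 p n).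

Definition lamp_shift (i : int) x :=
  lamp_mul (lamp_mul (lamp_inv (shifter i)) x) (shifter i).

Lemma lamp_shift_f i x m : lamp_f (lamp_shift i x) m = lamp_f x (m - i).
Proof. by rewrite /= oppr0 add0r addr0 !opprK. Qed.

Lemma lamp_shift_k i x : lamp_k (lamp_shift i x) = lamp_k x.
Proof. exact: conj_lamp_k. Qed.

Lemma lamp_shift_shift i j x : lamp_shift i (lamp_shift j x) = lamp_shift (i + j) x.
Proof.
apply: lamp_eq => [m|]; last by rewrite !lamp_shift_k.
by rewrite !lamp_shift_f opprD addrA.
Qed.

(** As [x] is tested after a shift to the right, this brings position [i] of [H] to the origin. *)
Definition translate (i : int) : SubSpace p n -> SubSpace p n :=
  conjS (shifter i).

Lemma translateE i H x : translate i H x = H (lamp_shift i x).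
Proof. by []. Qed.

Lemma translate_translate i j H :
  translate i (translate j H) = translate (i + j) H.
Proof. by apply/funext => x; rewrite !translateE lamp_shift_shift addrC. Qed.

Lemma conjS_continuous g : continuous (@conjS p n g).
Proof.
exact: (@continuous_precomp _ _
  (fun x : lamp => lamp_mul (lamp_mul (lamp_inv g) x) g)).
Qed.

Definition base_subgroups : set (SubSpace p n) :=
  [set H | is_subgroup H /\ forall x, H x -> lamp_k x = 0].

(** The base is abelian, so [g] acts on it only through its shift. *)
Lemma base_conjS g H : base_subgroups H ->
  conjS g H = translate (- lamp_k g) H.
Proof.
move=> [_ Hk]; apply/funext => x; rewrite translateE /conjS.
have [x0|x0] := eqVneq (lamp_k x) 0.
  congr (H _); apply: lamp_eq => [m|]; last by rewrite conj_lamp_k lamp_shift_k.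
  by rewrite conj_lamp_f// lamp_shift_f opprK.
transitivity false; last apply/esym; apply/negbTE/negP => /Hk;
  by rewrite ?conj_lamp_k ?lamp_shift_k => /eqP; rewrite (negbTE x0).
Qed.

Lemma subgroup_conjS g H : is_subgroup H -> is_subgroup (conjS g H).
Proof.
move=> hH; split.
  by rewrite /conjS lamp_mulr1 lamp_mulV subgroup1.
move=> x y hx hy; rewrite /conjS.
have -> : lamp_mul (lamp_mul (lamp_inv g) (lamp_mul x (lamp_inv y))) g =
   lamp_mul (lamp_mul (lamp_mul (lamp_inv g) x) g)
    (lamp_inv (lamp_mul (lamp_mul (lamp_inv g) y) g)).
  by rewrite !lamp_invM lamp_invK !lamp_mulA lamp_mulK.
exact: hH.2.
Qed.

Lemma base_translate i H : base_subgroups H -> base_subgroups (translate i H).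
Proof.
move=> [hH Hk]; split; first exact: subgroup_conjS.
by move=> x /Hk; rewrite conj_lamp_k.
Qed.

Lemma finsupp_restr (P : pred int) (f : int -> lvec p n) :
  finsupp f -> finsupp (fun m => if P m then f m else 0).
Proof. by move=> [N hN]; exists N => m /hN ->; case: ifP. Qed.

(** The shift component is set to zero; on the base this is the projection homomorphism onto the
    coordinates in [P]. *)
Definition restr (P : pred int) x : lamp :=
  Lamp 0 (finsupp_restr P (lamp_fin x)).

Definition supported (P : pred int) x := forall m, ~~ P m -> lamp_f x m = 0.

Lemma restr_id P x : lamp_k x = 0 -> supported P x -> restr P x = x.
Proof.
move=> k0 sx; apply: lamp_eq => [m|] //=.
by case: ifPn => // /sx.
Qed.

Lemma restr_one P x : supported (predC P) x -> restr P x = lamp_one p n.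
Proof.
move=> sx; apply: lamp_eq => [m|] //=.
by case: ifP => // Pm; apply: sx; rewrite /= Pm.
Qed.

Lemma restr_div P x y : lamp_k x = 0 -> lamp_k y = 0 ->
  restr P (lamp_mul x (lamp_inv y)) =
  lamp_mul (restr P x) (lamp_inv (restr P y)).
Proof.
move=> kx ky; apply: lamp_eq => [m|] /=; last by rewrite oppr0 addr0.
by rewrite kx ky !subr0 ?addr0; case: ifP => // _; rewrite subr0.
Qed.

Lemma restr_lamp_one P : restr P (lamp_one p n) = lamp_one p n.
Proof. by apply: lamp_eq => [m|] //=; case: ifP. Qed.

Definition window (N : nat) : pred int := fun m => (absz m <= N)%N.

Lemma windowW N M x : (N <= M)%N -> supported (window N) x -> supported (window M) x.
Proof.
by move=> NM h m hm; apply: h; apply: contra hm => /leq_trans; apply.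
Qed.

(** Finitely many elements have their supports in a common window. *)
Lemma supported_seq (s : seq lamp) : exists N, forall (H H' : SubSpace p n),
  (forall x, supported (window N) x -> H x = H' x) -> agree s H H'.
Proof.
elim: s => [|a s [N hN]]; first by exists 0%N.
have [M hM] := lamp_fin a; exists (N + M)%N => H H' h.
rewrite /agree /= h ?eqxx /=; last first.
  by move=> m; rewrite /window -ltnNge => hm; apply: hM; lia.
apply: hN => x sx; apply: h; apply: windowW sx; lia.
Qed.

End LampGroup.

(** * The perfect kernel *)

Section PerfectKernel.
Variables p n : nat.
Local Notation lamp := (lamp p n).
Implicit Types (x y z g : lamp) (H : SubSpace p n).

(** Each defining condition involves at most three coordinates, hence survives pointwise limits. *)
Lemma base_closed : closed (@base_subgroups p n).
Proof.
apply: closed_agreeP => H hH; split; first split.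
- have [H' [[H1 _] _]] := hH [:: lamp_one p n].
  by rewrite /agree /= andbT => /eqP <-.
- move=> x y; have [H' [[_ Hd] _]] := hH [:: x; y; lamp_mul x (lamp_inv y)].
  by rewrite /agree /= andbT => /and3P[/eqP <- /eqP <- /eqP <-]; apply: Hd.
- move=> x; have [H' [_ Hk]] := hH [:: x].
  by rewrite /agree /= andbT => /eqP <-; apply: Hk.
Qed.

(** This lemma and the next modify [H] without changing it on base elements supported in [P]: one
    keeps nothing else, the other is the preimage of [H] under restriction to [P]. *)
Lemma subgroup_cut (P : pred int) H : base_subgroups H ->
  base_subgroups (fun x => H x && `[< supported P x >]).
Proof.
move=> [hH Hk]; split; last by move=> x /andP[/Hk].
split; first by rewrite subgroup1//=; apply/asboolP.
move=> x y /andP[Hx /asboolP sx] /andP[Hy /asboolP sy].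
rewrite hH.2//=; apply/asboolP => m Pm /=.
by rewrite !Hk// subr0 addr0 sx// sy// subr0.
Qed.

Lemma subgroup_fill (P : pred int) H : base_subgroups H ->
  base_subgroups (fun x => (lamp_k x == 0) && H (restr P x)).
Proof.
move=> [hH Hk]; split; last by move=> x /andP[/eqP].
split; first by rewrite restr_lamp_one subgroup1//.
move=> x y /andP[/eqP kx Hx] /andP[/eqP ky Hy].
by rewrite restr_div//= kx ky subrr eqxx/=; apply: hH.2.
Qed.

Lemma base_agree (N : nat) s : (forall H H' : SubSpace p n,
  (forall x, supported (window N) x -> H x = H' x) -> agree s H H') ->
  forall H H', base_subgroups H -> base_subgroups H' ->
  (forall x, lamp_k x = 0 -> supported (window N) x -> H x = H' x) -> agree s H H'.
Proof.
move=> hs H H' [_ Hk] [_ Hk'] h; apply: hs => x sx.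
have [/eqP k0|k0] := boolP (lamp_k x == 0); first exact: h.
by apply/idP/idP => [/Hk|/Hk'] /eqP; rewrite (negbTE k0).
Qed.

Lemma finsupp_delta (i : int) (v : lvec p n) :
  finsupp (fun m => if m == i then v else 0).
Proof. by exists (absz i) => m hm; case: eqP => // e; rewrite e ltnn in hm. Qed.

Definition delta (i : int) (v : lvec p n) : lamp := Lamp 0 (finsupp_delta i v).

(** Cutting [H] at a large window and filling it outside the window both give subgroups close to
    [H]. These two differ from each other, so one of them differs from [H]. *)
Lemma base_perfect : (0 < n)%N -> perfect_set (@base_subgroups p n).
Proof.
move=> n0; split; first exact: base_closed.
apply/seteqP; split=> [H /limit_point_agree hH|H hH].
  apply: base_closed => U /nbhs_agreeP [s sU].
  by have [H' bH' [HH' _]] := hH s; exists H'; split=> //; apply: sU.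
apply/limit_point_agree => s; have [N hN] := supported_seq s.
pose H1 : SubSpace p n := fun x => H x && `[< supported (window N) x >].
pose H2 : SubSpace p n := fun x => (lamp_k x == 0) && H (restr (window N) x).
have bH1 : base_subgroups H1 by exact: subgroup_cut.
have bH2 : base_subgroups H2 by exact: subgroup_fill.
have [H1H|H1H] := pselect (H1 = H); last first.
  exists H1 => //; split=> //; apply: base_agree hN _ _ _ _ _ => // x _ sx.
  by rewrite /H1 asboolT ?andbT.
exists H2 => //; split.
  apply: base_agree hN _ _ _ _ _ => // x k0 sx.
  by rewrite /H2 k0 eqxx restr_id.
(* A nonzero vector just outside the window: its restriction is trivial, so it lies in [H2], but it
   is not supported in the window, so it is not in [H1]. *)
move=> H2H; pose x := delta N.+1%:Z (const_mx 1).
have : H2 x.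
  rewrite /H2 eqxx /= restr_one ?subgroup1//; first by case: hH.
  move=> m; rewrite /window /= negbK; case: eqP => // -> /=.
  by rewrite ltnn.
rewrite H2H -H1H => /andP[_ /asboolP /(_ N.+1%:Z)].
rewrite /window /= ltnn eqxx => /(_ isT) /matrixP /(_ ord0 (Ordinal n0)).
by rewrite !mxE => /eqP; rewrite oner_eq0.
Qed.

(** The part of [P] outside the closed set [Q] is relatively open in the perfect set [P] and
    countable, hence empty. By symmetry the perfect kernel is unique. *)
Lemma perfect_kernel_sub (P Q : set (SubSpace p n)) :
  is_perfect_kernel P -> is_perfect_kernel Q -> P `<=` Q.
Proof.
move=> [PS [pP _]] [_ [[cQ _] cntQ]].
have h : P `&` ~` Q = set0.
  apply: perfect_open_countable => //; first exact: closed_openC.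
  apply: sub_countable cntQ; apply: subset_card_le.
  by move=> x [/PS ? ?].
by move=> x Px; apply: contrapT => Qx; have : (P `&` ~` Q) x by []; rewrite h.
Qed.

End PerfectKernel.

(** * Subgroups outside the base: finite generation and countability *)

Lemma bounded_monotone_stationary (c : nat -> nat) (B : nat) :
  (forall l, c l <= c l.+1)%N -> (forall l, c l <= B)%N ->
  exists R, forall l, (R <= l)%N -> c l.+1 = c l.
Proof.
move=> cm cB.
have hom : {homo c : i j / (i <= j)%N} by exact: homo_leq leqnn leq_trans cm.
have [R /asboolP [l0 <-] maxR] :
    exists2 b, `[< exists l, c l = b >] & forall l, (c l <= b)%N.
  have ex : exists b, `[< exists l, c l = b >] by exists (c 0%N); apply/asboolP; exists 0%N.
  have ub b : `[< exists l, c l = b >] -> (b <= B)%N by move=> /asboolP [l <-].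
  case: (ex_maxnP ex ub) => b hb hmax; exists b => // l.
  by apply: hmax; apply/asboolP; exists l.
exists l0 => l hl; apply/eqP; rewrite eqn_leq cm andbT.
exact: leq_trans (maxR _) (hom _ _ hl).
Qed.

Section Countability.
Variables p n : nat.
Local Notation lamp := (lamp p n).
Implicit Types (x y z g : lamp) (H : SubSpace p n).

(** An element is determined by a bound [N] on its support, its [2N + 1] values on [[-N, N]] and its
    shift. *)
Lemma lamp_code : exists code : lamp -> nat, injective code.
Proof.
pose N x := projT1 (cid (lamp_fin x)).
have hN x m : (N x < absz m)%N -> lamp_f x m = 0.
  by move: m; exact: projT2 (cid (lamp_fin x)).
pose F x := mkseq (fun i => lamp_f x (i%:Z - (N x)%:Z)) (N x).*2.+1.
exists (fun x => pickle (N x, F x, lamp_k x)).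
move=> x y /(pcan_inj pickleK) e.
have eN : N x = N y := congr1 (fun q => q.1.1) e.
have es : F x = F y := congr1 (fun q => q.1.2) e.
apply: lamp_eq => [m|]; last exact: (congr1 (fun q => q.2) e).
have [hm|hm] := ltnP (N x) (absz m); first by rewrite !hN// -eN.
have hi : (absz (m + (N x)%:Z)%R < (N x).*2.+1)%N by lia.
have := congr1 (fun s => nth 0 s (absz (m + (N x)%:Z)%R)) es.
rewrite /F !nth_mkseq -?eN//.
by rewrite (_ : (absz (m + (N x)%:Z)%R)%:Z - (N x)%:Z = m); last lia.
Qed.

(** Conjugation by [g] shifts the base by [lamp_k g]; this is the module structure on the
    intersection of [H] with the base. *)
Lemma subgroup_shift H g x : is_subgroup H -> H g -> lamp_k x = 0 ->
  H (lamp_shift (lamp_k g) x) = H x.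
Proof.
move=> hH Hg kx.
have -> : lamp_shift (lamp_k g) x = lamp_mul (lamp_mul g x) (lamp_inv g).
  rewrite -{2}(lamp_invK g); apply: lamp_eq => [m|].
    by rewrite conj_lamp_f// lamp_shift_f.
  by rewrite conj_lamp_k lamp_shift_k.
by rewrite subgroupMr ?subgroupVE// subgroupMl.
Qed.

Let pos (l : nat) : pred int := fun m => (0 <= m) && (m < l%:Z).

(** Base elements supported in [[0, l]] are vector polynomials of degree at most [l]; these are
    their coefficients at [t^l], zero included. *)
Definition leading H (l : nat) : {set 'rV['F_p]_n} :=
  [set v | `[< exists x, [/\ H x, lamp_k x = 0, supported (pos l.+1) x
             & lamp_f x l = v] >] ].

Lemma leadingP H l (v : 'rV['F_p]_n) :
  reflect (exists x, [/\ H x, lamp_k x = 0, supported (pos l.+1) x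
                      & lamp_f x l = v]) (v \in leading H l).
Proof. by rewrite finset.in_set; exact: asboolP. Qed.

(* Hilbert's basis theorem for the [F_p[t^k, t^-k]]-module [H `&` base]: the
   sets of leading coefficients in degree [l] increase along [l, l + k, ...],
   hence are eventually [k]-periodic in [l]. *)
Lemma leading_stationary H g (k : nat) : is_subgroup H -> H g ->
  lamp_k g = k%:Z ->
  exists R, forall l, (R <= l)%N -> leading H (l + k) = leading H l.
Proof.
move=> hH Hg kg.
have sub l : leading H l \subset leading H (l + k).
  apply/fintype.subsetP => v /leadingP [x [Hx kx sx xl]].
  apply/leadingP; exists (lamp_shift k%:Z x); split.
  - by rewrite -kg subgroup_shift.
  - by rewrite lamp_shift_k.
  - by move=> m hm; rewrite lamp_shift_f; apply: sx; move: hm; rewrite /pos; lia.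
  - by rewrite lamp_shift_f -xl; congr (lamp_f x _); lia.
(* Summing over [k] consecutive degrees treats all residues modulo [k] at once: [c] is nondecreasing
   and bounded, and once it is stationary the inclusions [sub] are equalities. *)
pose c l := (\sum_(j < k) #|leading H (l + j)|)%N.
have cS l : (c l.+1 + #|leading H l| = c l + #|leading H (l + k)|)%N.
  transitivity (\sum_(j < k.+1) #|leading H (l + j)|)%N; last by rewrite big_ord_recr.
  rewrite big_ord_recl addn0 addnC; congr (_ + _)%N.
  by apply: eq_bigr => i _; rewrite addSnnS.
have [||R hR] := @bounded_monotone_stationary c (k * #|{: 'rV['F_p]_n}|)%N.
- by move=> l; rewrite -(leq_add2r #|leading H l|) cS leq_add2l subset_leq_card.
- move=> l; rewrite /c -[X in (_ <= X * _)%N]card_ord -sum_nat_const.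
  by apply: leq_sum => i _; exact: max_card.
exists R => l /hR h; apply/eqP; rewrite eq_sym eqEcard sub /=.
by rewrite -(leq_add2l (c l)) -cS h.
Qed.

(** The generators are an element [g] of minimal positive shift [k] and one polynomial for each
    leading coefficient in each degree below [R + k]. *)
Lemma finitely_generated H : is_subgroup H -> ~ base_subgroups H ->
  exists s : seq lamp, all H s /\
    forall H', is_subgroup H' -> all H' s -> forall x, H x -> H' x.
Proof.
move=> hH nbH.
have [g0 Hg0 kg0] : exists2 g, H g & lamp_k g <> 0.
  by apply: contrapT => h; apply: nbH; split=> // x Hx; apply: contrapT => ?; apply: h; exists x.
pose Q (k : nat) := (0 < k)%N && `[< exists2 g, H g & lamp_k g = k%:Z >].
have exQ : exists k, Q k.
  exists (absz (lamp_k g0)); apply/andP; split; first lia.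
  apply/asboolP; have [h|h] := leP 0 (lamp_k g0); first by exists g0 => //; lia.
  by exists (lamp_inv g0); rewrite ?subgroupVE//=; lia.
case: (ex_minnP exQ) => k /andP[k0 /asboolP [g Hg kg]] kmin.
have {}kmin x : H x -> lamp_k x <> 0 -> (k <= absz (lamp_k x))%N.
  move=> Hx kx; apply: kmin; apply/andP; split; first lia.
  apply/asboolP; have [h|h] := leP 0 (lamp_k x); first by exists x => //; lia.
  by exists (lamp_inv x); rewrite ?subgroupVE//=; lia.
have [R hR] := leading_stationary hH Hg kg.
(* A representative of each leading coefficient; [g] is a dummy value for the other vectors. *)
have hy (lv : nat * lvec p n) : exists x, lv.2 \in leading H lv.1 ->
    [/\ H x, lamp_k x = 0, supported (pos lv.1.+1) x & lamp_f x lv.1 = lv.2].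
  have [|nv] := boolP (lv.2 \in leading H lv.1); last by exists g.
  by move=> /leadingP [x hx]; exists x.
have {hy} [y hy] := choice hy.
exists (g :: [seq y lv | lv <- [seq (l, v) | l <- iota 0 (R + k), v <- enum (leading H l)]]).
split.
  rewrite /= Hg all_map; apply/allP => _ /allpairsPdep [l [v [_ vl ->]]] /=.
  by rewrite mem_enum in vl; have [] := hy (l, v) vl.
move=> H' hH'; rewrite /= all_map => /andP[H'g /allP H's].
have lead l v : v \in leading H l -> exists x,
    [/\ H x, H' x, lamp_k x = 0 & supported (pos l.+1) x /\ lamp_f x l = v].
  elim/ltn_ind: l v => l IH v vl; have [lt|ge] := ltnP l (R + k).
    have [h1 h2 h3 h4] := hy (l, v) vl; exists (y (l, v)); split=> //.
    apply: (H's (l, v)); apply/allpairsPdep; exists l, v; split=> //.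
      by rewrite mem_iota.
    by rewrite mem_enum.
  (* Here [R <= l - k], so degrees [l - k] and [l] have the same leading coefficients, and a shift
     by [k] passes from one to the other. *)
  have [||x [Hx H'x kx [sx xv]]] := IH (l - k)%N _ v; first by lia.
    by rewrite -hR ?subnK//; lia.
  exists (lamp_shift k%:Z x); rewrite lamp_shift_k -kg !subgroup_shift//; split=> //.
  split; last by rewrite lamp_shift_f -xv; congr (lamp_f x _); lia.
  by move=> m hm; rewrite lamp_shift_f; apply: sx; move: hm; rewrite /pos; lia.
(* Polynomial division: subtracting an element with the same top coefficient lowers the degree. *)
have base_pos l x : H x -> lamp_k x = 0 -> supported (pos l) x -> H' x.
  elim: l x => [|l IH] x Hx kx sx.
    suff -> : x = lamp_one p n by exact: subgroup1.
    by apply: lamp_eq => // m; apply: sx; rewrite /pos; lia.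
  have [|z [Hz H'z kz [sz zl]]] := lead l (lamp_f x l).
    by apply/leadingP; exists x.
  rewrite -(subgroupMr x hH' (subgroupV hH' H'z)); apply: IH.
  - exact: hH.2.
  - by rewrite /= kx kz.
  - move=> m hm /=; rewrite kx kz !subr0 ?addr0.
    have [->|ml] := eqVneq m l%:Z; first by rewrite zl subrr.
    by rewrite sx ?sz ?subr0//; move: hm ml; rewrite /pos; lia.
(* Repeated shifts by [k] to the right make the support nonnegative, and both [H] and [H'] are
   stable under them. *)
have base_H' x : H x -> lamp_k x = 0 -> H' x.
  have [N hN] := lamp_fin x.
  have : supported (fun m => - N%:Z <= m) x.
    by move=> m hm; apply: hN; lia.
  have [M] : exists M : nat, supported (fun m => m < M%:Z) x.
    by exists N.+1 => m hm; apply: hN; lia.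
  elim: N x M {hN} => [|a IH] x M sM sN Hx kx.
    apply: (base_pos M) => // m; rewrite /pos negb_and => /orP[]; last exact: sM.
    by move=> h; apply: sN; lia.
  rewrite -(subgroup_shift hH' H'g kx) kg; apply: (IH _ (M + k)%N).
  - by move=> m hm; rewrite lamp_shift_f; apply: sM; lia.
  - by move=> m hm; rewrite lamp_shift_f; apply: sN; lia.
  - by rewrite -kg subgroup_shift.
  - by rewrite lamp_shift_k.
(* Euclidean division of the shift by [k]: a nonzero shift in [H] is at least [k] in absolute value,
   so multiplying by [g] or its inverse decreases it. *)
move=> x; move: {2}(absz _).+1 (ltnSn (absz (lamp_k x))) => b.
elim: b x => // b IH x xb Hx.
have [/eqP k00|/eqP kx] := boolP (lamp_k x == 0); first exact: base_H'.
have kk := kmin _ Hx kx.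
have [h|h] := leP 0 (lamp_k x).
  rewrite -(subgroupMr x hH' (subgroupV hH' H'g)); apply: IH.
    by rewrite /=; lia.
  exact: hH.2.
rewrite -(subgroupMr x hH' H'g); apply: IH; last exact: subgroupM.
by rewrite /=; lia.
Qed.

(** Two such subgroups with the same finite generating list contain each other, so a code of the
    list determines the subgroup. *)
Lemma countable_nonbase : countable (@SubG p n `\` @base_subgroups p n).
Proof.
have [code inj] := lamp_code.
have h (H : SubSpace p n) : exists s : seq lamp, (@SubG p n `\` @base_subgroups p n) H ->
  all H s /\ forall H', is_subgroup H' -> all H' s -> forall x, H x -> H' x.
  have [[h1 h2]|nh] := pselect ((@SubG p n `\` @base_subgroups p n) H); last by exists [::].
  by have [s hs] := finitely_generated h1 h2; exists s.
have {h} [s hs] := choice h.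
apply/countable_injP; exists (fun H => pickle (map code (s H))) => H H'.
rewrite !inE => hH hH' /(pcan_inj pickleK) /(inj_map inj) e.
have [a1 b1] := hs _ hH; have [a2 b2] := hs _ hH'.
apply/funext => x; apply/idP/idP.
  by apply: b1; [exact: hH'.1 | rewrite e].
by apply: b2; [exact: hH.1 | rewrite -e].
Qed.

Lemma base_perfect_kernel : (0 < n)%N -> is_perfect_kernel (@base_subgroups p n).
Proof.
move=> n0; split; first by move=> H [].
split; [exact: base_perfect | exact: countable_nonbase].
Qed.

Lemma perfect_kernelE (K : set (SubSpace p n)) : (0 < n)%N ->
  is_perfect_kernel K -> K = @base_subgroups p n.
Proof.
move=> n0 hK; have hB := base_perfect_kernel n0.
by apply/seteqP; split; apply: perfect_kernel_sub.
Qed.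

End Countability.

(** * Empirical measures *)

(** The weights are approximated by rational ones with a common denominator, realised as
    multiplicities in a list; the bound is uniform in [g]. *)
Lemma empirical_distribution (R : realType) (Q : finType) (w : Q -> R) (B e : R) :
  (forall q, 0 <= w q) -> \sum_q w q = 1 -> 0 < B -> 0 < e ->
  exists2 l : seq Q, (0 < size l)%N & forall g : Q -> R, (forall q, `|g q| <= B) ->
    `|(size l)%:R^-1 * \sum_(q <- l) g q - \sum_q w q * g q| <= e.
Proof.
move=> w0 w1 B0 e0; pose C : R := #|Q|%:R.
(* Each [q] will be repeated [M * w q] times, rounded up. The final error is at most
   [2 * C * B / M], whence this choice of [M]. *)
pose M := (Num.truncn (2 * C * B / e)).+1.
have [k hk] : exists k : Q -> nat, forall q, 0 <= (k q)%:R - M%:R * w q <= 1.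
  exists (fun q => (Num.truncn (M%:R * w q)).+1) => q.
  have /andP[h1 h2] := truncn_itv (mulr_ge0 (ler0n R M) (w0 q)).
  by rewrite subr_ge0 ltW//= -natr1 lerBlDr addrC lerD2l.
pose l := flatten [seq nseq (k q) q | q <- enum Q].
have suml (g : Q -> R) : \sum_(q <- l) g q = \sum_q (k q)%:R * g q.
  rewrite /l big_flatten /= big_map big_enum /=; apply: eq_bigr => q _.
  by rewrite big_nseq iter_addr_0 mulr_natl.
have sizel : (size l)%:R = \sum_q (k q)%:R :> R.
  by rewrite -sum1_size natr_sum suml; apply: eq_bigr => q _; rewrite mulr1.
have sumM : \sum_q M%:R * w q = M%:R by rewrite -mulr_sumr w1 mulr1.
have sizeM : M%:R <= (size l)%:R :> R.
  rewrite sizel -sumM; apply: ler_sum => q _.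
  by rewrite -subr_ge0; case/andP: (hk q).
have sizeC : (size l)%:R - M%:R <= C.
  rewrite sizel -sumM -sumrB /C -sum1_card natr_sum.
  by apply: ler_sum => q _; case/andP: (hk q).
have M0 : 0 < M%:R :> R by rewrite ltr0n.
have s0 : 0 < (size l)%:R :> R by exact: lt_le_trans sizeM.
exists l; first by rewrite -(ltr0n R).
move=> g gB.
have -> : (size l)%:R^-1 * \sum_(q <- l) g q - \sum_q w q * g q =
   (size l)%:R^-1 * \sum_q ((k q)%:R - (size l)%:R * w q) * g q.
  under [in RHS]eq_bigr do rewrite mulrBl -mulrA.
  rewrite sumrB -mulr_sumr mulrBr mulKf ?gt_eqF// suml.
  by congr (_ - _).
rewrite normrM gtr0_norm ?invr_gt0// ler_pdivrMl//.
(* The difference [k q - size l * w q] is a rounding error in [[0, 1]] minus [(size l - M) * w q],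
   which lies in [[0, C * w q]]. *)
have h : `|\sum_q ((k q)%:R - (size l)%:R * w q) * g q| <= \sum_q (1 + C * w q) * B.
  apply: le_trans (ler_norm_sum _ _ _) _; apply: ler_sum => q _.
  rewrite normrM; apply: ler_pM => //.
  have /andP[h1 h2] := hk q.
  have h3 : 0 <= ((size l)%:R - M%:R) * w q by rewrite mulr_ge0// subr_ge0.
  have h4 : ((size l)%:R - M%:R) * w q <= C * w q by rewrite ler_wpM2r.
  by rewrite ler_norml; apply/andP; split; nra.
apply: le_trans h _; rewrite -mulr_suml big_split /= -mulr_sumr w1 mulr1.
rewrite sumr_const cardT -cardE -/C.
apply: (@le_trans _ _ (M%:R * e)); last by rewrite ler_wpM2r// ltW.
rewrite -ler_pdivrMr//.
have C0 : 0 <= 2 * C * B / e.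
  by rewrite !mulr_ge0// ?ler0n// ?invr_ge0 ltW.
have /andP[_ h2] := truncn_itv C0.
rewrite /M; apply: le_trans (ltW h2); rewrite -mulr2n mulr_natl; lra.
Qed.

(** * Integrals of bounded functions and sampling of a probability measure *)

Section Probability.
Context d (T : measurableType d) (R : realType) (mu : probability T R).

Lemma bounded_integrable (D : set T) (f : T -> R) (B : R) :
  measurable D -> measurable_fun setT f -> (forall x, `|f x| <= B) ->
  mu.-integrable D (EFin \o f).
Proof.
move=> mD mf fB; apply: measurable_bounded_integrable => //.
- by rewrite (le_lt_trans (probability_le1 _ mD))// ltry.
- exact: measurable_funTS.
- exists B; split; first exact: num_real.
  by move=> M BM x _; apply: le_trans (fB x) (ltW BM).
Qed.

Lemma EFin_Rintegral (f : T -> R) (B : R) :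
  measurable_fun setT f -> (forall x, `|f x| <= B) ->
  (\int[mu]_x (f x)%:E)%E = (\int[mu]_x f x)%:E.
Proof.
move=> mf fB; rewrite fineK//; apply: integrable_fin_num => //.
exact: (bounded_integrable measurableT mf fB).
Qed.

Lemma Rintegral_full (K : set T) (f : T -> R) (B : R) :
  measurable K -> mu K = 1%E -> measurable_fun setT f ->
  (forall x, `|f x| <= B) -> \int[mu]_x f x = \int[mu]_(x in K) f x.
Proof.
move=> mK K1 mf fB; rewrite /Rintegral; congr fine.
have K0 : mu (~` K) = 0%E by rewrite probability_setC// K1 subee.
have int := bounded_integrable measurableT mf fB.
by rewrite (negligible_integral (measurableC mK) measurableT int K0) setDE setTI setCK.
Qed.

Lemma Rintegral_finite_range (Q : finType) (c : T -> Q) (g : Q -> R) (K : set T) :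
  measurable K -> (forall q, measurable (c @^-1` [set q])) ->
  \int[mu]_(x in K) g (c x) = \sum_q g q * fine (mu (c @^-1` [set q] `&` K)).
Proof.
move=> mK mc.
have ind (x : T) : (g (c x))%:E = (\sum_q (g q)%:E * (\1_(c @^-1` [set q]) x)%:E)%E.
  rewrite (bigD1 (c x))//= big1 ?addr0 => [|q qc].
    by rewrite indicE mem_set ?mule1 ?adde0.
  by rewrite indicE memNset ?mule0// => /= /esym/eqP; rewrite (negbTE qc).
rewrite /Rintegral; under eq_integral do rewrite ind.
have int_ind q : mu.-integrable K (fun x => (\1_(c @^-1` [set q]) x)%:E : \bar R).
  apply: (@bounded_integrable _ _ 1) => //.
  by move=> x; rewrite indicE; case: (_ \in _); rewrite ?normr1 ?normr0.
rewrite integral_sum//; last by move=> q; exact: integrableZl.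
under eq_bigr do rewrite integralZl// integral_indic//.
rewrite -sum_fine => [|q _]; last first.
  by rewrite fin_numM// fin_num_measure//; exact: measurableI.
apply: eq_bigr => q _; rewrite fineM// fin_num_measure//; exact: measurableI.
Qed.

Lemma Rintegral_sum (k : nat) (g : nat -> T -> R) (B : R) :
  (forall i, measurable_fun setT (g i)) -> (forall i x, `|g i x| <= B) ->
  \int[mu]_x (\sum_(i < k) g i x) = \sum_(i < k) \int[mu]_x g i x.
Proof.
move=> mg gB; rewrite /Rintegral; under eq_integral do rewrite -sumEFin.
rewrite integral_sum//; last first.
  by move=> i; exact: (bounded_integrable measurableT (mg i) (gB i)).
rewrite -sum_fine// => i _; apply: integrable_fin_num => //.
exact: (bounded_integrable measurableT (mg i) (gB i)).
Qed.

Lemma Rintegral_invariant (phi : T -> T) (f : T -> R) (B : R) :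
  measurable_fun setT phi ->
  (forall A, measurable A -> mu (phi @^-1` A) = mu A) ->
  measurable_fun setT f -> (forall x, `|f x| <= B) ->
  \int[mu]_x f (phi x) = \int[mu]_x f x.
Proof.
move=> mphi inv mf fB; rewrite /Rintegral; congr fine.
have := @integral_pushforward _ _ _ _ _ phi mphi mu setT (EFin \o f).
rewrite preimage_setT => <-//; first by apply: eq_measure_integral => //= A mA _; exact: inv.
- exact/measurable_EFinP.
- apply: (bounded_integrable measurableT (measurableT_comp mf mphi)) => x.
  exact: fB.
Qed.

(** The fibres of [c] are finitely many cells on which each [f i] oscillates by at most [e].
    Replacing [f i] by its values at representatives costs [e], and replacing the law of [c] by an
    empirical one costs another [e]. *)
Lemma empirical_sample (Q : finType) (c : T -> Q) (K : set T) (m : nat)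
    (f : nat -> T -> R) (B e : R) :
  measurable K -> mu K = 1%E -> (forall q, measurable (c @^-1` [set q])) ->
  0 < B -> 0 < e ->
  (forall i, (i < m)%N -> measurable_fun setT (f i)) ->
  (forall i x, (i < m)%N -> `|f i x| <= B) ->
  (forall i x y, (i < m)%N -> c x = c y -> `|f i x - f i y| <= e) ->
  exists2 l : seq T, (0 < size l)%N /\ (forall x, x \in l -> K x) &
    forall i, (i < m)%N ->
      `|(size l)%:R^-1 * \sum_(x <- l) f i x - \int[mu]_x f i x| <= e + e.
Proof.
move=> mK K1 mc B0 e0 mf fB fosc.
have [x0 Kx0] : K !=set0.
  apply/set0P/negP => /eqP K0; move: K1; rewrite K0 measure0 => /esym/eqP.
  by rewrite onee_eq0.
(* A cell that misses [K] gets the default [x0], so that all representatives lie in [K]. *)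
have hx q : exists x, K x /\ ((exists2 y, K y & c y = q) -> c x = q).
  have [[y Ky cy]|h] := pselect (exists2 y, K y & c y = q); first by exists y.
  by exists x0; split=> // /h.
have {hx} [xq hxq] := choice hx.
have cstK (r : R) : \int[mu]_(_ in K) r = r.
  by rewrite Rintegral_cst// [X in r * fine X](_ : _ = 1%E)//= mulr1.
pose w q := fine (mu (c @^-1` [set q] `&` K)).
have w1 : \sum_q w q = 1.
  have := @Rintegral_finite_range Q c (fun=> 1) K mK mc.
  rewrite cstK => ->.
  by apply: eq_bigr => q _; rewrite mul1r.
have w0 q : 0 <= w q by exact/fine_ge0/measure_ge0.
have [l l0 hl] := empirical_distribution w0 w1 B0 e0.
exists [seq xq q | q <- l].
  by rewrite size_map; split=> // _ /mapP [q _ ->]; case: (hxq q).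
move=> i im; rewrite size_map big_map.
have h1 := hl (fun q => f i (xq q)) (fun q => fB i (xq q) im).
apply: le_trans (ler_distD (\sum_q w q * f i (xq q)) _ _) _.
apply: lerD => //.
have -> : \sum_q w q * f i (xq q) = \int[mu]_(x in K) f i (xq (c x)).
  rewrite (Rintegral_finite_range (fun q => f i (xq q)))//.
  by apply: eq_bigr => q _; rewrite mulrC.
rewrite (Rintegral_full mK K1 (mf i im) (fB i ^~ im)).
have mfc : measurable_fun setT (fun x => f i (xq (c x))).
  move=> _ Y mY; rewrite setTI.
  rewrite (_ : _ @^-1` Y = \bigcup_(q in [set q | Y (f i (xq q))]) c @^-1` [set q]).
    by apply: fin_bigcup_measurable => //; exact: finite_finset.
  apply/seteqP; split=> [x Yx|x [q Yq /= ->]//]; by exists (c x).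
have fcB x : `|f i (xq (c x))| <= B by exact: fB.
have mfi := mf i im; have fiB x := fB i x im.
have int1 := bounded_integrable mK mfc fcB.
have int2 := bounded_integrable mK (mf i im) (fB i ^~ im).
rewrite -RintegralB//; apply: le_trans (le_normr_Rintegral mK _) _.
  by apply: (@bounded_integrable _ _ (B + B)) => //;
    [exact: (measurable_funB mfc mfi)|move=> x; apply: le_trans (ler_normB _ _) _; apply: lerD].
rewrite -[leRHS]cstK.
apply: le_Rintegral => //.
- apply: (@bounded_integrable _ _ (B + B)) => //.
    by apply: measurableT_comp => //; exact: (measurable_funB mfc mfi).
  move=> x; rewrite normr_id; apply: le_trans (ler_normB _ _) _; exact: lerD.
- by apply: (@bounded_integrable _ _ `|e|) => //.
- move=> x Kx; apply: fosc => //.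
  by have [_ ->] := hxq (c x); last by exists x.
Qed.

End Probability.

(** * Averages of point masses *)

Section AverageDirac.
Context d (T : measurableType d) (R : realType).
Variables (x : nat -> T) (k : nat).

Definition average_dirac : set T -> \bar R :=
  mscale (k.+1%:R^-1)%:nng (msum (fun i => \d_(x i)) k.+1).

HB.instance Definition _ := Measure.on average_dirac.

Lemma average_diracE (A : set T) :
  average_dirac A = (k.+1%:R^-1 * \sum_(i < k.+1) \1_A (x i))%:E.
Proof.
rewrite /average_dirac /mscale /msum /= EFinM -sumEFin; congr (_ * _)%E.
Qed.

Lemma average_dirac_setT : average_dirac setT = 1%E.
Proof.
rewrite average_diracE; under eq_bigr do rewrite indicT.
by rewrite sumr_const card_ord mulVf.
Qed.

HB.instance Definition _ :=
  Measure_isProbability.Build _ _ _ average_dirac average_dirac_setT.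

Lemma Rintegral_average_dirac (f : T -> R) (B : R) :
  measurable_fun setT f -> (forall y, `|f y| <= B) ->
  \int[average_dirac]_y f y = k.+1%:R^-1 * \sum_(i < k.+1) f (x i).
Proof.
move=> mf fB.
have mfB : measurable_fun setT (fun y => f y + B) by exact: measurable_funD.
(* Adding [B] makes the integrand nonnegative, so that the integral splits over the sum of measures;
   the constant is removed afterwards. *)
have pos : \int[average_dirac]_y (f y + B) =
    k.+1%:R^-1 * \sum_(i < k.+1) (f (x i) + B).
  rewrite /Rintegral ge0_integral_mscale//; last 2 first.
  - exact/measurable_EFinP.
  - by move=> y _; rewrite lee_fin; have := fB y; rewrite ler_norml; lra.
  rewrite ge0_integral_measure_sum//; last 2 first.
  - by move=> y _; rewrite lee_fin; have := fB y; rewrite ler_norml; lra.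
  - exact/measurable_EFinP.
  have di i : (\int[\d_(x i)]_y (f y + B)%:E = (f (x i) + B)%:E)%E.
    rewrite integral_dirac//; last exact/measurable_EFinP.
    by rewrite diracT mul1e.
  under eq_bigr do rewrite di.
  by rewrite sumEFin -EFinM.
move: pos; rewrite RintegralD//; last 2 first.
- exact: (bounded_integrable _ measurableT mf fB).
- exact: (@bounded_integrable _ _ _ _ _ _ `|B|).
rewrite Rintegral_cst// [X in B * fine X]average_dirac_setT mulr1 big_split /= sumr_const card_ord.
rewrite mulrDr -[B *+ _]mulr_natl mulKf ?pnatr_eq0//.
exact: addIr.
Qed.

End AverageDirac.

(** * Density of periodic measures *)

Section Concatenation.
Variables (p n : nat) (L : nat) (Hs : int -> SubSpace p n).
Hypothesis bHs : forall j, base_subgroups (Hs j).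
Implicit Types x y : lamp p n.

Definition block : pred int := fun m => (0 <= m) && (m < L%:Z).

(** The part of [x] in [[jL, (j+1)L)], moved back to [[0, L)]. *)
Definition block_at (j : int) x : lamp p n :=
  restr block (lamp_shift (- (j * L%:Z)) x).

(* The direct sum over [j] of the parts of [Hs j] supported in [[0, L)],
   moved to [[jL, (j+1)L)]. *)
Definition concat : SubSpace p n :=
  fun x => (lamp_k x == 0) && `[< forall j, Hs j (block_at j x) >].

Lemma base_concat : base_subgroups concat.
Proof.
split; last by move=> x /andP[/eqP].
have shift_one i : lamp_shift i (lamp_one p n) = lamp_one p n.
  by apply: lamp_eq => [m|]; rewrite ?lamp_shift_k// lamp_shift_f.
have shift_div i x y : lamp_k x = 0 -> lamp_k y = 0 ->
    lamp_shift i (lamp_mul x (lamp_inv y)) =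
    lamp_mul (lamp_shift i x) (lamp_inv (lamp_shift i y)).
  have fdiv (a b : lamp p n) m : lamp_f (lamp_mul a (lamp_inv b)) m =
      lamp_f a m - lamp_f b (m - lamp_k a + lamp_k b) by [].
  have kdiv (a b : lamp p n) : lamp_k (lamp_mul a (lamp_inv b)) =
      lamp_k a - lamp_k b by [].
  move=> kx ky; apply: lamp_eq => [m|]; last by rewrite lamp_shift_k !kdiv !lamp_shift_k.
  by rewrite lamp_shift_f !fdiv !lamp_shift_f !lamp_shift_k kx ky !subr0 ?addr0.
split.
  apply/andP; split=> //; apply/asboolP => j.
  by rewrite /block_at shift_one restr_lamp_one; apply: subgroup1; case: (bHs j).
move=> x y /andP[/eqP kx /asboolP hx] /andP[/eqP ky /asboolP hy].
apply/andP; split; first by rewrite /= kx ky.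
apply/asboolP => j; rewrite /block_at shift_div// restr_div ?lamp_shift_k//.
by have [[_ h] _] := bHs j; apply: h; [exact: hx | exact: hy].
Qed.

Lemma concat_periodic (M : nat) : (forall j, Hs (j + M%:Z) = Hs j) ->
  translate (M * L)%N%:Z concat = concat.
Proof.
move=> per; apply/funext => x; rewrite translateE /concat lamp_shift_k.
congr (_ && _); apply: asbool_equiv_eq.
have e j : block_at (j + M%:Z) (lamp_shift (M * L)%N%:Z x) = block_at j x.
  rewrite /block_at lamp_shift_shift.
  by rewrite (_ : - ((j + M%:Z) * L%:Z) + (M * L)%N%:Z = - (j * L%:Z)) // PoszM; ring.
split=> h j; first by rewrite -e -per.
by have := h (j - M%:Z); rewrite -e subrK -per subrK.
Qed.

(** The two inequalities keep a window of radius [r] around position [l] inside block [j]; all other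
    blocks then see the identity. *)
Lemma concat_local (r l : nat) (j : int) x : lamp_k x = 0 ->
  supported (window r) x -> (r <= l)%N -> (l + r < L)%N ->
  translate (j * L%:Z + l%:Z) concat x = translate l%:Z (Hs j) x.
Proof.
move=> kx sx rl lr; rewrite !translateE /concat lamp_shift_k kx eqxx /=.
have e : block_at j (lamp_shift (j * L%:Z + l%:Z) x) = lamp_shift l%:Z x.
  rewrite /block_at lamp_shift_shift addKr restr_id ?lamp_shift_k//.
  move=> m hm; rewrite lamp_shift_f; apply: sx; move: hm.
  by rewrite /window /block; lia.
apply/asboolP/idP => [/(_ j)|h i]; first by rewrite e.
have [->|ij] := eqVneq i j; first by rewrite e.
rewrite /block_at lamp_shift_shift restr_one; first by apply: subgroup1; case: (bHs i).
move=> m /negbNE hm; rewrite lamp_shift_f; apply: sx; move: hm.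
rewrite /window /block -ltnNge => /andP[m0 mL].
have [lt|ge] := ltP i j.
  have : (i + 1) * L%:Z <= j * L%:Z by apply: ler_wpM2r => //; lia.
  by rewrite mulrDl mul1r; lia.
have : (j + 1) * L%:Z <= i * L%:Z by apply: ler_wpM2r => //; lia.
by rewrite mulrDl mul1r; lia.
Qed.

End Concatenation.

(** * Borel structure on the space of subgroups *)

Section BorelSub.
Variables (p n : nat) (R : realType).

Lemma open_measurable_Sub (A : set (SubSpace p n)) :
  open A -> measurable (A : set (BorelSub p n)).
Proof. by move=> oA; apply: sub_sigma_algebra. Qed.

Lemma closed_measurable_Sub (A : set (SubSpace p n)) :
  closed A -> measurable (A : set (BorelSub p n)).
Proof.
move=> cA; rewrite -(setCK A); apply: measurableC.
by apply: open_measurable_Sub; exact: closed_openC.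
Qed.

Lemma continuous_measurable_Sub (f : SubSpace p n -> R) :
  continuous f -> measurable_fun setT (f : BorelSub p n -> R).
Proof.
move=> /continuousP cf; apply: (measurability _ (RGenOpens.measurableE R)).
move=> _ [_ [a [b ->] <-]]; rewrite setTI; apply: open_measurable_Sub.
by apply: cf; exact: interval_open.
Qed.

Lemma conjS_measurable (g : lamp p n) :
  measurable_fun setT (conjS g : BorelSub p n -> BorelSub p n).
Proof.
apply: (@measurability _ _ (BorelSub p n) (BorelSub p n) setT (conjS g)
  (@open (SubSpace p n))) => //.
move=> _ [A oA <-]; rewrite setTI; apply: open_measurable_Sub.
by apply: open_comp => // x _; exact: conjS_continuous.
Qed.

(** The cells of the finite partition by traces on [s], along which an invariant measure will be
    sampled. *)
Lemma restriction_measurable (s : seq (lamp p n)) (q : (size s).-tuple bool) :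
  measurable ([set H : SubSpace p n | map_tuple H (in_tuple s) = q]
    : set (BorelSub p n)).
Proof.
apply: open_measurable_Sub; rewrite openE => H /= <-.
apply: filterS (nbhs_agree s H) => H' /= HH'; apply/val_inj => /=.
move: HH'; rewrite /agree /=; elim: s {q} => //= a s IH /andP[/eqP -> /IH ->].
by [].
Qed.

End BorelSub.

(** * Invariant measures on periodic orbits and their extremality *)

Lemma periodic_sum (V : zmodType) (F : int -> V) (k : nat) (a : int) :
  (forall i, F (i + k%:Z) = F i) -> \sum_(i < k) F (i%:Z + a) = \sum_(i < k) F i%:Z.
Proof.
move=> per; pose G b := \sum_(i < k) F (i%:Z + b).
have GS b : G (b + 1) = G b.
  apply: (@addrI _ (F b)); rewrite /G [RHS]addrC -[X in _ = _ + X](per b).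
  (* The sum over [k.+1] terms, split at its first and at its last term, compares [G (b + 1)] with
     [G b]. *)
  transitivity (\sum_(i < k.+1) F (i%:Z + b)).
    rewrite big_ord_recl add0r; congr (_ + _); apply: eq_bigr => i _.
    by congr F; rewrite /= /bump /=; lia.
  by rewrite big_ord_recr /= addrC [k%:Z + b]addrC addrC.
have -> : \sum_(i < k) F i%:Z = G 0 by apply: eq_bigr => i _; rewrite addr0.
rewrite -/(G a); elim/int_ind: a => // b IH; first by rewrite -addn1 PoszD GS.
by rewrite -IH -[in RHS](subrK 1 (- b%:Z)) GS; congr G; lia.
Qed.

Section PeriodicMeasure.
Variables (p n : nat) (R : realType) (W : SubSpace p n) (k : nat).
Hypothesis bW : base_subgroups W.
Hypothesis perW : translate k.+1%:Z W = W.

Let orbit (i : nat) : BorelSub p n := translate i%:Z W.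

(** Here [k.+1] is a period of [W], perhaps not the least, so the enumeration may run through the
    orbit several times. *)
Definition orbit_measure : probability (BorelSub p n) R := average_dirac R orbit k.

Lemma orbit_measureE (A : set (BorelSub p n)) :
  orbit_measure A = (k.+1%:R^-1 * \sum_(i < k.+1) \1_A (translate i%:Z W : BorelSub p n))%:E.
Proof. exact: average_diracE. Qed.

Lemma translate_sum (V : zmodType) (F : SubSpace p n -> V) (a : int) :
  \sum_(i < k.+1) F (translate (i%:Z + a) W) = \sum_(i < k.+1) F (translate i%:Z W).
Proof.
apply: (periodic_sum (F := fun i => F (translate i W))) => i.
by rewrite -translate_translate perW.
Qed.

(** On the base, conjugation is a translation, which only reindexes a sum over a full period. *)
Lemma orbit_measure_IRS : IRS_star (@base_subgroups p n) orbit_measure.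
Proof.
split.
  rewrite orbit_measureE (eq_bigr (fun=> 1)) => [|i _]; last first.
    by rewrite indicE mem_set//; exact: base_translate.
  by rewrite sumr_const card_ord mulVf.
move=> g A mA; rewrite !orbit_measureE; congr (_ * _)%:E.
rewrite -[RHS](translate_sum (fun H => \1_A (H : BorelSub p n)) (- lamp_k g)).
apply: eq_bigr => i _; rewrite addrC -translate_translate -base_conjS//.
exact: base_translate.
Qed.

Lemma measure_translate (m : probability (BorelSub p n) R) (i : int)
    (A : set (BorelSub p n)) :
  IRS_star (@base_subgroups p n) m -> measurable A ->
  m (translate i @^-1` A) = m A.
Proof. by case=> _ invm mA; exact: (invm (shifter p n i) A mA). Qed.

(* On the orbit of [W], the frequency of visits to [A] is constant, equal to
   [orbit_measure A]; integrating it against an invariant measure carried by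
   the orbit gives the measure of [A]. *)
Lemma orbit_measure_unique (m : probability (BorelSub p n) R) :
  IRS_star (@base_subgroups p n) m ->
  (forall A : set (BorelSub p n), measurable A -> orbit_measure A = 0%E -> m A = 0%E) ->
  forall A, measurable A -> m A = orbit_measure A.
Proof.
move=> invm acm A mA.
pose h (H : BorelSub p n) : R :=
  \sum_(i < k.+1) \1_A (translate i%:Z H : BorelSub p n).
have mtr i : measurable_fun setT (translate i : BorelSub p n -> BorelSub p n).
  exact: conjS_measurable.
have mind i : measurable_fun setT
    (fun H : BorelSub p n => \1_A (translate i H : BorelSub p n) : R).
  apply: (@measurableT_comp _ _ _ _ _ _ (\1_A : BorelSub p n -> R)) => //.
have mh : measurable_fun setT h.
  by apply: measurable_sum => i; exact: mind.
have indB (i : int) (H : BorelSub p n) : `|\1_A (translate i H : BorelSub p n) : R| <= 1.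
  by rewrite indicE; case: (_ \in _); rewrite ?normr1 ?normr0.
pose c : R := \sum_(i < k.+1) \1_A (translate i%:Z W : BorelSub p n).
pose E := h @^-1` [set c].
have mE : measurable E by rewrite -[E]setTI; exact: mh.
have hW (i : int) : h (translate i W) = c.
  rewrite /h /c -(translate_sum (fun H => \1_A (H : BorelSub p n)) i).
  by apply: eq_bigr => j _; rewrite translate_translate.
(* The orbit of [W] lies in [E], so the complement of [E] is null for [orbit_measure], hence for
   [m]. *)
have mE1 : m E = 1%E.
  rewrite -(setCK E) probability_setC; last exact: measurableC.
  rewrite acm ?sube0//; first exact: measurableC.
  rewrite orbit_measureE big1 ?mulr0// => i _.
  by rewrite indicE memNset//= => /(_ (hW i)).
have hB H : `|h H| <= k.+1%:R.
  apply: le_trans (ler_norm_sum _ _ _) _.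
  apply: le_trans (ler_sum _ (fun i _ => indB _ _)) _.
  by rewrite sumr_const card_ord.
(* The integral of [h] is computed twice: [h] equals [c] almost everywhere, and by invariance each
   of its [k.+1] terms integrates to [m A]. *)
have e1 : \int[m]_H h H = c.
  rewrite (Rintegral_full mE mE1 mh hB).
  rewrite (@eq_Rintegral _ _ _ _ _ (fun=> c)); last by move=> H; rewrite inE.
  by rewrite Rintegral_cst// [X in c * fine X](_ : _ = 1%E)//= mulr1.
have e2 : \int[m]_H h H = k.+1%:R * fine (m A).
  rewrite (Rintegral_sum m (g := fun i H => \1_A (translate i%:Z H : BorelSub p n))
    k.+1 (fun i => mind i%:Z) (fun i => indB i%:Z)).
  rewrite (eq_bigr (fun=> fine (m A))) ?sumr_const ?card_ord ?mulr_natl// => i _.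
  rewrite /Rintegral; congr fine.
  rewrite -(measure_translate i%:Z invm mA) -[in RHS](setIT (_ @^-1` _)).
  rewrite -integral_indic//.
  by rewrite -[_ @^-1` _]setTI; exact: mtr.
rewrite orbit_measureE -/c -e1 e2 mulKf// fineK// fin_num_measure//.
Qed.

(** Both components of a proper convex combination vanish on the null sets of the orbit measure,
    hence equal it by [orbit_measure_unique]. *)
Lemma orbit_measure_extreme : IRS_extreme (@base_subgroups p n) orbit_measure.
Proof.
split; first exact: orbit_measure_IRS.
move=> m1 m2 t I1 I2 /andP[t0 t1] conv A mA.
have t1' : 0 < 1 - t by rewrite subr_gt0.
have ge0 (s : R) (m : probability (BorelSub p n) R) B : 0 < s -> (0 <= s%:E * m B)%E.
  by move=> s0; rewrite mule_ge0// lee_fin ltW.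
split; apply: orbit_measure_unique => // B mB nuB.
  have := conv B mB; rewrite nuB => /esym/eqP.
  rewrite padde_eq0 ?ge0// => /andP[+ _].
  by rewrite mule_eq0 eqe (gt_eqF t0) => /eqP.
have := conv B mB; rewrite nuB => /esym/eqP.
rewrite padde_eq0 ?ge0// => /andP[_].
by rewrite mule_eq0 eqe (gt_eqF t1') => /eqP.
Qed.

End PeriodicMeasure.

(** * Approximation of an invariant measure by orbit measures *)

Section Density.
Variables (p n : nat) (R : realType).
Local Notation base := (@base_subgroups p n).

Lemma sum_blocks (V : zmodType) (F : nat -> V) (M L : nat) :
  \sum_(a < M * L) F a = \sum_(j < M) \sum_(l < L) F (j * L + l)%N.
Proof.
elim: M => [|M IH]; first by rewrite mul0n !big_ord0.
rewrite big_ord_recr /= -IH mulSn addnC -!(big_mkord xpredT F).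
rewrite -(big_mkord xpredT (fun l => F (M * L + l)%N)).
rewrite (@big_cat_nat _ _ _ (M * L)%N) ?leq_addr//=; congr (_ + _).
by rewrite -{1}[(M * L)%N]add0n big_addn addKn; apply: eq_bigr => i _; rewrite addnC.
Qed.

(** At most [2r] indices, near the two ends, can differ by more than [e]; each costs at most [2B],
    and [4rB <= eL]. *)
Lemma average_close (L r : nat) (a b : nat -> R) (B e : R) :
  (0 < L)%N -> 0 < B -> 0 < e -> 4 * r%:R * B <= e * L%:R ->
  (forall l, `|a l| <= B) -> (forall l, `|b l| <= B) ->
  (forall l, (r <= l)%N -> (l + r < L)%N -> `|a l - b l| <= e) ->
  `|L%:R^-1 * \sum_(l < L) a l - L%:R^-1 * \sum_(l < L) b l| <= e + e.
Proof.
move=> L0 B0 e0 hL aB bB ab; have L0' : 0 < L%:R :> R by rewrite ltr0n.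
rewrite -mulrBr -sumrB normrM gtr0_norm ?invr_gt0// ler_pdivrMl//.
have count_lt k : \sum_(l < L) (l < k)%N%:R <= k%:R :> R.
  suff -> : \sum_(l < L) (l < k)%N%:R = (minn L k)%:R :> R by rewrite ler_nat geq_minr.
  elim: L {L0 hL ab L0'} => [|L IH]; first by rewrite big_ord0 min0n.
  by rewrite big_ord_recr /= IH -natrD; congr _%:R; case: ltnP => /=; lia.
have count_ge : \sum_(l < L) (L <= l + r)%N%:R <= r%:R :> R.
  apply: le_trans (count_lt r); rewrite (reindex_inj rev_ord_inj) /=.
  apply: ler_sum => l _; rewrite ler_nat; case: l => l hl /=.
  by apply: (@leq_trans (l < r)%N) => //; case: leqP => //; lia.
apply: le_trans (ler_norm_sum _ _ _) _.
apply: (@le_trans _ _ (\sum_(l < L) (e + ((l < r)%N%:R + (L <= l + r)%N%:R) * (2 * B)))).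
  apply: ler_sum => l _.
  have ab2 : `|a l - b l| <= 2 * B.
    by apply: le_trans (ler_normB _ _) _; have := aB l; have := bB l; lra.
  have [lr|rl] := ltnP l r.
    by apply: le_trans ab2 _; case: (_ <= _)%N; rewrite /= ?mulr1n; nra.
  have [Lr|rL] := leqP L (l + r)%N; last by rewrite addr0 mul0r addr0; exact: ab.
  by apply: le_trans ab2 _; rewrite add0r mul1r lerDr ltW.
rewrite big_split /= sumr_const card_ord -mulr_suml big_split /=.
have := count_lt r; rewrite -mulr_natl; nra.
Qed.

Lemma orbit_measure_dense (mu : probability (BorelSub p n) R) (m : nat)
    (f : nat -> SubSpace p n -> R) (eps : R) :
  IRS_star base mu -> (forall i, (i < m)%N -> continuous (f i)) -> 0 < eps ->
  exists nu : probability (BorelSub p n) R, IRS_extreme base nu /\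
    forall i, (i < m)%N ->
      `|\int[nu]_x f i x - \int[mu]_x f i x| < eps.
Proof.
move=> muI cf eps0; pose e := eps / 5.
have e0 : 0 < e by rewrite divr_gt0.
have mK : measurable (base : set (BorelSub p n)).
  by apply: closed_measurable_Sub; exact: base_closed.
have mf i : (i < m)%N -> measurable_fun setT (f i : BorelSub p n -> R).
  by move=> im; apply: continuous_measurable_Sub; exact: cf.
have [B B0 fB] := continuous_bounded_family cf.
have [s hs] := agree_uniform_family cf e0.
have [r hr] := supported_seq s.
(* The block length is large enough for the two ends of a block to contribute at most [e] to an
   average over it. *)
pose L := (Num.truncn (4 * r%:R * B / e)).+1.
have L0' : 0 < L%:R :> R by rewrite ltr0n.
have hL : 4 * r%:R * B <= e * L%:R.
  have C0 : 0 <= 4 * r%:R * B / e by rewrite !mulr_ge0 ?invr_ge0// ltW.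
  rewrite [leRHS]mulrC -ler_pdivrMr//; apply: ltW.
  by have /andP[] := truncn_itv C0.
(* The average of [f i] along [L] translates. By invariance it has the same [mu]-integral as [f i],
   and its value at a sampled subgroup is what a block of [W] reproduces. *)
pose psi i (H : BorelSub p n) : R := L%:R^-1 * \sum_(l < L) f i (translate l%:Z H).
have cftr i (l : int) : (i < m)%N -> continuous (fun H => f i (translate l H)).
  move=> im H; apply: continuous_comp; first exact: conjS_continuous.
  exact: cf.
have cpsi i : (i < m)%N -> continuous (psi i : SubSpace p n -> R).
  move=> im H; apply: cvgM; first exact: cvg_cst.
  apply: (continuous_big (op := +%R) (P := xpredT)) => [|l _]; last exact: cftr.
  exact: add_continuous.
have psiB i H : (i < m)%N -> `|psi i H| <= B.
  move=> im; rewrite normrM gtr0_norm ?invr_gt0// ler_pdivrMl//.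
  apply: le_trans (ler_norm_sum _ _ _) _.
  apply: le_trans (ler_sum _ (fun l _ => fB i _ im)) _.
  by rewrite sumr_const card_ord mulr_natl.
have int_psi i : (i < m)%N -> \int[mu]_x psi i x = \int[mu]_x f i x.
  move=> im; rewrite /psi.
  have mftr (l : int) : measurable_fun setT (fun H : BorelSub p n => f i (translate l H)).
    by apply: continuous_measurable_Sub; exact: cftr.
  have ftrB (l : int) (H : BorelSub p n) : `|f i (translate l H)| <= B by exact: fB.
  rewrite RintegralZl//; last first.
    apply: (@bounded_integrable _ _ _ _ _ _ (L%:R * B)) => //.
      by apply: measurable_sum => l; exact: mftr.
    move=> H; apply: le_trans (ler_norm_sum _ _ _) _.
    apply: le_trans (ler_sum _ (fun l _ => fB i _ im)) _.
    by rewrite sumr_const card_ord mulr_natl.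
  rewrite (Rintegral_sum mu (g := fun l (H : BorelSub p n) => f i (translate l%:Z H))
    L (fun l => mftr l%:Z) (fun l => ftrB l%:Z)).
  rewrite (eq_bigr (fun=> \int[mu]_x f i x)) => [|l _].
    by rewrite sumr_const card_ord -[X in _ * X]mulr_natl mulKf// gt_eqF.
  apply: (Rintegral_invariant (phi := translate l%:Z : BorelSub p n -> BorelSub p n)
    (B := B)) => //.
  - exact: conjS_measurable.
  - by move=> A mA; apply: measure_translate.
  - exact: mf.
  - by move=> H; exact: fB.
(* Subgroups with the same trace on [t] have [psi] values within [e], so the traces on [t] give the
   partition for sampling. *)
have [t ht] := agree_uniform_family cpsi e0.
have [||l [l0 hl] hemp] := @empirical_sample _ (BorelSub p n) R mu
  _ (fun H : BorelSub p n => map_tuple H (in_tuple t)) base m psi B e mK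
  muI.1 (@restriction_measurable p n t) B0 e0 _ psiB.
- by move=> i im; apply: continuous_measurable_Sub; exact: cpsi.
- move=> i H H' im /(congr1 val) /= HH'; apply/ltW/ht => //.
  rewrite /agree /=; elim: t {ht} HH' => //= a t IH [-> /IH ->].
  by rewrite eqxx.
pose M := size l.
have M0 : 0 < M%:R :> R by rewrite ltr0n.
(* The samples are repeated cyclically, which makes [W] periodic; the index stays below [M], so the
   default [point] is never taken. *)
pose Hs (j : int) : SubSpace p n := nth point l (absz (j %% M%:Z)%Z).
have hHs j : base (Hs j).
  apply: hl; apply: mem_nth.
  have Mz : M%:Z != 0 by rewrite /M; lia.
  by have := ltz_mod j Mz; have := modz_ge0 j Mz; rewrite -/M; lia.
pose W := concat L Hs.
have bW : base W by exact: base_concat.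
have perHs j : Hs (j + M%:Z) = Hs j by rewrite /Hs modzDr.
(* An orbit measure takes its period in the form [k.+1], hence the predecessor of the positive
   number [M * L]. *)
have perW : translate (M * L).-1.+1%:Z W = W.
  by rewrite prednK ?muln_gt0 ?l0//; exact: concat_periodic.
exists (orbit_measure R W (M * L).-1); split; first exact: orbit_measure_extreme.
move=> i im.
have -> : \int[orbit_measure R W (M * L).-1]_x f i x =
    M%:R^-1 * \sum_(j < M) (L%:R^-1 * \sum_(l < L) f i (translate (j%:Z * L%:Z + l%:Z) W)).
  rewrite (Rintegral_average_dirac _ _ (mf i im) (fB i ^~ im)).
  rewrite prednK ?muln_gt0 ?l0// (sum_blocks (fun a => f i (translate a%:Z W))).
  by rewrite natrM invfM -mulrA; congr (_ * _); rewrite mulr_sumr.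
(* The ends of the blocks cost [e + e], the sampling costs [e + e], and the fifth [e] makes the
   inequality strict. *)
have -> : eps = e + e + (e + e) + e by rewrite /e; lra.
apply: le_lt_trans (ler_distD (M%:R^-1 * \sum_(H <- l) psi i H) _ _) _.
rewrite -[ltLHS]addr0; apply: ler_ltD => //; apply: lerD; last first.
  by rewrite -(int_psi i im); exact: hemp.
rewrite (big_nth point) big_mkord -/M -mulrBr -sumrB normrM gtr0_norm ?invr_gt0//.
rewrite ler_pdivrMl//; apply: le_trans (ler_norm_sum _ _ _) _.
rewrite mulr_natl -[X in _ <= _ *+ X]card_ord -sumr_const; apply: ler_sum => j _.
apply: (@average_close L r (fun k => f i (translate (j%:Z * L%:Z + k%:Z) W))
  (fun k => f i (translate k%:Z (nth point l j))) B) => // [k|k|k rk kr].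
- exact: fB.
- exact: fB.
apply/ltW/hs => //.
apply: (base_agree hr).
- exact: base_translate.
- by apply: base_translate; have := hHs j%:Z; rewrite /Hs modz_nat absz_nat modn_small.
move=> x kx sx; rewrite (concat_local hHs j%:Z kx sx rk kr).
by rewrite /Hs modz_nat absz_nat modn_small.
Qed.

End Density.

Theorem theorem1p2 (R : realType) (p n : nat) :
  prime p -> (1 <= n)%N ->
  (exists K : set (SubSpace p n), is_perfect_kernel K) /\
  forall K : set (SubSpace p n), is_perfect_kernel K ->
    IRS_extreme_dense R K.
Proof.
move=> _ n0; split; first by exists (@base_subgroups p n); exact: base_perfect_kernel.
move=> K /(perfect_kernelE n0) -> mu muI m f eps cf eps0.
have [nu [exnu hnu]] := orbit_measure_dense muI cf eps0.
exists nu; split=> // i im; have [B _ fB] := continuous_bounded (cf i im).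
have mf : measurable_fun setT (f i : BorelSub p n -> R).
  by apply: continuous_measurable_Sub; exact: cf.
by rewrite (EFin_Rintegral nu mf fB) (EFin_Rintegral mu mf fB) lte_fin hnu.
Qed.
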